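(* For $a=(a_n)\in w$ define the matrix $B^{\lambda}=(b_{nk}^{\lambda})_{n,k\in\mathbb{N}}$ by $$b_{nk}^{\lambda}=\begin{cases}(-1)^{n-k}\dfrac{\lambda_k}{\lambda_n-\lambda_{n-1}}a_n, & n-1\leq k\leq n,\\ 0, & k<n-1\ \text{or}\ k>n,\end{cases}$$ and define the sets $$m_1^{\lambda}=\left\{a=(a_n)\in w:\sup_{N,K\in\mathcal{F}}\left|\sum_{n\in N}\sum_{k\in K}(b_{nk}^{\lambda}-b_{n,k-1}^{\lambda})\right|<\infty\right\},$$ $$m_2^{\lambda}=\left\{a=(a_n)\in w:\sup_{N,K\in\mathcal{F}}\left|\sum_{n\in N}\sum_{k\in K}(b_{nk}^{\lambda}-b_{n,k+1}^{\lambda})\right|<\infty\right\}.$$ Then $\{cs^{\lambda}\}^{\alpha}=m_1^{\lambda}$ and $\{cs_0^{\lambda}\}^{\alpha}=\{bs^{\lambda}\}^{\alpha}=m_2^{\lambda}$.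
   Context: $\mathbb{N}=\{0,1,2,\dots\}$, $w=\mathbb{C}^{\mathbb{N}}$ is the space of all complex sequences, and $\mathcal{F}$ is the collection of all finite subsets of $\mathbb{N}$. Any term with a negative subscript is $0$. $\lambda=(\lambda_k)_{k\in\mathbb{N}}$ is a fixed strictly increasing sequence of positive reals tending to infinity (so $\lambda_{-1}=0$). For $x=(x_k)\in w$ put $\Lambda(x)=(\Lambda_n(x))_{n\in\mathbb{N}}$, $\Lambda_n(x)=\frac{1}{\lambda_n}\sum_{k=0}^{n}(\lambda_k-\lambda_{k-1})x_k$. $cs$, $cs_0$, $bs$ are the spaces of sequences $x\in w$ whose sequence of partial sums $\left(\sum_{n=0}^m x_n\right)_m$ is, respectively, convergent, convergent to $0$, bounded. Define $cs^{\lambda}=\{x\in w:\Lambda(x)\in cs\}$, $cs_0^{\lambda}=\{x\in w:\Lambda(x)\in cs_0\}$, $bs^{\lambda}=\{x\in w:\Lambda(x)\in bs\}$. The $\alpha$-dual of a sequence space $X$ is $X^{\alpha}=\{a\in w: (a_kx_k)\in\ell_1\ \text{for all}\ x=(x_k)\in X\}$, where $\ell_1$ is the space of absolutely summable sequences. *)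

(* Defs.v *)
From Stdlib Require Import Reals List Arith Bool.
From Coquelicot Require Import Coquelicot.

Open Scope R_scope.

Definition w : Type := nat -> C.

(* The term of index n - 1 of a sequence, a term of negative index being 0. *)
Definition prevR (u : nat -> R) (n : nat) : R :=
  match n with O => 0 | S m => u m end.

Definition prevC (u : nat -> C) (n : nat) : C :=
  match n with O => RtoC 0 | S m => u m end.

Definition cs (x : w) : Prop := ex_series x.

Definition cs0 (x : w) : Prop := is_series x (RtoC 0).

Definition bs (x : w) : Prop :=
  exists M : R, forall m : nat, Cmod (sum_n x m) <= M.

Definition l1 (x : w) : Prop := ex_series (fun k => Cmod (x k)).

Definition Lambda (lam : nat -> R) (x : w) : w := fun n =>
  (RtoC (1 / lam n) *
     sum_n (fun k => (RtoC (lam k - prevR lam k) * x k)%C) n)%C.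

Definition cs_lambda (lam : nat -> R) (x : w) : Prop := cs (Lambda lam x).

Definition cs0_lambda (lam : nat -> R) (x : w) : Prop := cs0 (Lambda lam x).

Definition bs_lambda (lam : nat -> R) (x : w) : Prop := bs (Lambda lam x).

Definition alpha_dual (X : w -> Prop) (a : w) : Prop :=
  forall x : w, X x -> l1 (fun k => (a k * x k)%C).

(* The test n - 1 <= k is written n <= k + 1, since subtraction on nat
   truncates. *)
Definition B_lambda (lam : nat -> R) (a : w) (n k : nat) : C :=
  if ((n <=? k + 1) && (k <=? n))%nat
  then (RtoC ((-1) ^ (n - k) * (lam k / (lam n - prevR lam n))) * a n)%C
  else RtoC 0.

(* A finite set of naturals is represented by a duplicate-free list. *)
Definition sum_over (N : list nat) (f : nat -> C) : C :=
  fold_right Cplus (RtoC 0) (map f N).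

Definition sup_finite (d : nat -> nat -> C) : Rbar :=
  Lub_Rbar (fun r : R => exists N K : list nat,
    NoDup N /\ NoDup K /\
    r = Cmod (sum_over N (fun n => sum_over K (fun k => d n k)))).

Definition m1_lambda (lam : nat -> R) (a : w) : Prop :=
  Rbar_lt
    (sup_finite (fun n k =>
       (B_lambda lam a n k - prevC (B_lambda lam a n) k)%C))
    p_infty.

Definition m2_lambda (lam : nat -> R) (a : w) : Prop :=
  Rbar_lt
    (sup_finite (fun n k =>
       (B_lambda lam a n k - B_lambda lam a n (k + 1))%C))
    p_infty.

(* Main.v *)
(* All three duals and both sets equal
   [{a | sum_n lam_n / (lam_n - lam_(n-1)) |a_n| < oo}].
   Writing [y = Lambda x] and [s] for the partial sums of [y], one has
   [(lam_n - lam_(n-1)) x_n = lam_n y_n - lam_(n-1) y_(n-1)], so this condition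
   suffices when [s] is bounded.  Conversely, for [s_n = (-1)^n eps_n] with
   [eps_n > 0] tending to [0], [|a_n x_n|] is at least [eps_n] times the [n]-th
   term of the series, and Abel-Dini shows that the series converges.  Since
   [B^lambda] has two diagonals of size at most the [n]-th term, the condition
   bounds the finite double sums; conversely, taking for [K] an initial segment
   of the even numbers adds up the row [n] without cancellation. *)
Require Import Defs.
From Stdlib Require Import Reals List FinFun Arith Lra Lia.
From Coquelicot Require Import Coquelicot.

(** * Series with nonnegative terms and the Abel-Dini argument *)

Lemma ex_series_nonneg_bounded (c : nat -> R) (M : R) :
  (forall n, 0 <= c n) -> (forall n, sum_n c n <= M) -> ex_series c.
Proof.
  intros Hc HM.
  destruct (ex_finite_lim_seq_incr (sum_n c) M) as [l Hl]; trivial.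
  - intros n. rewrite sum_Sn. unfold plus; simpl. specialize (Hc (S n)). lra.
  - exists l. exact Hl.
Qed.

Lemma sum_n_le_is_series (c : nat -> R) (l : R) (n : nat) :
  (forall k, 0 <= c k) -> is_series c l -> sum_n c n <= l.
Proof.
  intros Hc Hl.
  apply (is_lim_seq_incr_compare (sum_n c) l Hl).
  intros k. rewrite sum_Sn. unfold plus; simpl. specialize (Hc (S k)). lra.
Qed.

(* Abel-Dini: the weights [1 / (1 + S n)], with [S] the partial sums of [c],
   violate the hypothesis when [S] is unbounded. *)
Lemma summable_of_null_weights (c : nat -> R) :
  (forall n, 0 <= c n) ->
  (forall eps : nat -> R, (forall n, 0 < eps n) -> is_lim_seq eps 0 ->
     ex_series (fun n => eps n * c n)) ->
  ex_series c.
Proof.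
  intros Hc Heps.
  set (s := sum_n c : nat -> R).
  assert (Hs : forall n, s (S n) = s n + c (S n))
    by (intros n; apply (sum_Sn c)).
  assert (Hs0 : forall n, 0 <= s n).
  { induction n as [|n IH].
    - unfold s. rewrite sum_O. apply Hc.
    - rewrite Hs. specialize (Hc (S n)). lra. }
  assert (Hincr : forall n, s n <= s (S n))
    by (intros n; rewrite Hs; specialize (Hc (S n)); lra).
  assert (Hmono : forall n p, s n <= s (n + p)%nat).
  { intros n. induction p as [|p IH].
    - rewrite Nat.add_0_r. lra.
    - rewrite Nat.add_succ_r. specialize (Hincr (n + p)%nat). lra. }
  destruct (ex_lim_seq_incr s Hincr) as [[l| |] Hl].
  - exists l. exact Hl.
  (* The summand 1 keeps the weights defined and positive even where the partial sum is 0. *)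
  - set (eps := fun n => / (1 + s n)).
    assert (Hpos : forall n, 0 < eps n)
      by (intros n; apply Rinv_0_lt_compat; specialize (Hs0 n); lra).
    destruct (Heps eps Hpos) as [t Ht].
    { apply (is_lim_seq_inv (fun n => 1 + s n) p_infty); [|discriminate].
      apply (is_lim_seq_le_p_loc s); trivial.
      exists 0%nat. intros n _. lra. }
    assert (Hle := fun n => sum_n_le_is_series _ _ n
      (fun k => Rmult_le_pos _ _ (Rlt_le _ _ (Hpos k)) (Hc k)) Ht).
    (* Choose [m] so that the weighted series contributes less than 1/2 after index [m]. *)
    assert (Hm := proj2 (is_lim_seq_spec (sum_n (fun n => eps n * c n)) (Finite t)) Ht).
    destruct (Hm (mkposreal (/2) ltac:(lra))) as [m Hm']; simpl in Hm'.
    specialize (Hm' m (Nat.le_refl m)). apply Rabs_def2 in Hm'.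
    (* The weights decrease, so every weight between [m] and [m + p] is at least the last one,
       [eps (m + p)]. *)
    assert (Htail : forall p, (s (m + p)%nat - s m) * eps (m + p)%nat <=
      sum_n (fun n => eps n * c n) (m + p) - sum_n (fun n => eps n * c n) m).
    { induction p as [|p IH].
      - rewrite Nat.add_0_r. lra.
      - rewrite Nat.add_succ_r, sum_Sn. unfold plus; simpl.
        apply Rle_trans with
          ((s (m + p)%nat - s m) * eps (m + p)%nat
           + eps (S (m + p)) * c (S (m + p))); [|lra].
        rewrite Hs. ring_simplify.
        specialize (Hmono m p).
        assert (eps (S (m + p)) <= eps (m + p)%nat).
        { apply Rinv_le_contravar; [specialize (Hs0 (m + p)%nat); lra|].
          specialize (Hincr (m + p)%nat). lra. }
        nra. }
    (* With s' = s_(m+n), the tail estimate reads (s' - s_m) / (1 + s') <= 1/2, which rearranges to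
       s' <= 1 + 2 s_m. *)
    apply (ex_series_nonneg_bounded c (1 + 2 * s m)); trivial.
    intros n. fold (s n).
    apply Rle_trans with (s (m + n)%nat).
    { rewrite Nat.add_comm. apply Hmono. }
    specialize (Htail n). specialize (Hle (m + n)%nat).
    assert (Heq : eps (m + n)%nat * (1 + s (m + n)%nat) = 1)
      by (apply Rinv_l; specialize (Hs0 (m + n)%nat); lra).
    assert (Hhalf : (s (m + n)%nat - s m) * eps (m + n)%nat <= / 2) by lra.
    specialize (Hpos (m + n)%nat). specialize (Hs0 (m + n)%nat).
    nra.
  - exfalso. apply is_lim_seq_spec in Hl. destruct (Hl 0) as [n Hn].
    specialize (Hn n (Nat.le_refl n)). specialize (Hs0 n). lra.
Qed.

(** * Sums over finite sets of naturals *)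

Definition sumR_over (N : list nat) (f : nat -> R) : R :=
  fold_right Rplus 0 (map f N).

Lemma sumR_over_app (N K : list nat) (f : nat -> R) :
  sumR_over (N ++ K) f = sumR_over N f + sumR_over K f.
Proof.
  unfold sumR_over. induction N as [|n N IH]; simpl; [ring|].
  rewrite IH. ring.
Qed.

Lemma sumR_over_seq (f : nat -> R) (n : nat) :
  sumR_over (seq 0 (S n)) f = sum_n f n.
Proof.
  induction n as [|n IH].
  - rewrite sum_O. unfold sumR_over; simpl. ring.
  - rewrite seq_S, sumR_over_app, IH, sum_Sn.
    unfold sumR_over, plus; simpl. ring.
Qed.

Lemma sumR_over_ge_0 (N : list nat) (f : nat -> R) :
  (forall n, 0 <= f n) -> 0 <= sumR_over N f.
Proof.
  intros Hf. unfold sumR_over. induction N as [|n N IH]; simpl; [lra|].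
  specialize (Hf n). lra.
Qed.

Lemma sumR_over_le (N : list nat) (f g : nat -> R) :
  (forall n, f n <= g n) -> sumR_over N f <= sumR_over N g.
Proof.
  intros Hfg. unfold sumR_over. induction N as [|n N IH]; simpl; [lra|].
  specialize (Hfg n). lra.
Qed.

Lemma sumR_over_plus (N : list nat) (f g : nat -> R) :
  sumR_over N (fun n => f n + g n) = sumR_over N f + sumR_over N g.
Proof.
  unfold sumR_over. induction N as [|n N IH]; simpl; [ring|].
  rewrite IH. ring.
Qed.

Lemma sumR_over_scal (N : list nat) (r : R) (f : nat -> R) :
  sumR_over N (fun n => r * f n) = r * sumR_over N f.
Proof.
  unfold sumR_over. induction N as [|n N IH]; simpl; [ring|].
  rewrite IH. ring.
Qed.

(** Each head of [N] is cut out of [K]; as [N] has no duplicates, its tail is still contained in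
    what remains of [K]. *)
Lemma sumR_over_incl (N K : list nat) (f : nat -> R) :
  (forall n, 0 <= f n) -> NoDup N -> incl N K ->
  sumR_over N f <= sumR_over K f.
Proof.
  intros Hf HN. revert K.
  induction HN as [|n N Hn HN IH]; intros K HK.
  - apply sumR_over_ge_0, Hf.
  - destruct (in_split n K (HK n (or_introl eq_refl))) as [K1 [K2 ->]].
    assert (Hincl : incl N (K1 ++ K2)).
    { intros k Hk. specialize (HK k (or_intror Hk)).
      rewrite in_app_iff in *. simpl in HK.
      destruct HK as [|[->|]]; tauto. }
    specialize (IH _ Hincl). rewrite sumR_over_app in *.
    unfold sumR_over in *; simpl. lra.
Qed.

Lemma sumR_over_le_is_series (N : list nat) (f : nat -> R) (l : R) :
  (forall n, 0 <= f n) -> is_series f l -> NoDup N -> sumR_over N f <= l.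
Proof.
  intros Hf Hl HN.
  apply Rle_trans with (sumR_over (seq 0 (S (list_max N))) f).
  - apply sumR_over_incl; trivial.
    intros n Hn. apply in_seq.
    assert (Hmax := proj1 (list_max_le N _) (Nat.le_refl _)).
    rewrite Forall_forall in Hmax. specialize (Hmax n Hn). lia.
  - rewrite sumR_over_seq. apply sum_n_le_is_series; trivial.
Qed.

Definition indicator (j k : nat) : R := if Nat.eqb k j then 1 else 0.

Lemma indicator_ge_0 (j k : nat) : 0 <= indicator j k.
Proof. unfold indicator. destruct (Nat.eqb k j); lra. Qed.

Lemma indicator_eq (j k : nat) : k = j -> indicator j k = 1.
Proof. intros ->. unfold indicator. now rewrite Nat.eqb_refl. Qed.

Lemma sumR_over_indicator_le (K : list nat) (j : nat) :
  NoDup K -> sumR_over K (indicator j) <= 1.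
Proof.
  intros HK.
  (* The induction needs the second clause: if the head is [j], the tail must contribute nothing. *)
  assert (H : sumR_over K (indicator j) <= 1 /\
              (~ In j K -> sumR_over K (indicator j) <= 0)).
  { unfold sumR_over. induction HK as [|k K Hk HK [IH1 IH2]]; simpl.
    - lra.
    - unfold indicator at 1 3. destruct (Nat.eqb_spec k j) as [->|Hkj].
      + specialize (IH2 Hk). split; [lra|tauto].
      + split; [lra|]. intros Hj. rewrite Rplus_0_l. tauto. }
  apply H.
Qed.

Lemma Cmod_sum_over_le (N : list nat) (f : nat -> C) :
  Cmod (sum_over N f) <= sumR_over N (fun n => Cmod (f n)).
Proof.
  unfold sum_over, sumR_over. induction N as [|n N IH]; simpl.
  - rewrite Cmod_0. lra.
  - eapply Rle_trans; [apply Cmod_triangle|]. lra.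
Qed.

(** Used with [phi] the real or the imaginary part. Splitting [L] by the sign of [phi (t n)] turns
    the absolute values into two subset sums without cancellation, each bounded by [M]. *)
Lemma sumR_over_Rabs_le (phi : C -> R) (t : nat -> C) (M : R) (L : list nat) :
  phi (RtoC 0) = 0 ->
  (forall x y, phi (x + y)%C = phi x + phi y) ->
  (forall x, Rabs (phi x) <= Cmod x) ->
  (forall N, NoDup N -> Cmod (sum_over N t) <= M) ->
  NoDup L -> sumR_over L (fun n => Rabs (phi (t n))) <= 2 * M.
Proof.
  intros H0 Hadd Hphi HM HL.
  set (p := fun n => if Rle_dec 0 (phi (t n)) then true else false).
  assert (Hsplit : sumR_over L (fun n => Rabs (phi (t n))) =
    phi (sum_over (filter p L) t)
    - phi (sum_over (filter (fun n => negb (p n)) L) t)).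
  { clear HL. unfold sumR_over, sum_over.
    induction L as [|n L IH]; simpl; [rewrite H0; ring|].
    rewrite IH. clear IH.
    destruct (p n) eqn:E; simpl; rewrite Hadd; unfold p in E;
      destruct (Rle_dec 0 (phi (t n))) as [Hn|Hn]; try discriminate.
    - rewrite Rabs_pos_eq by trivial. ring.
    - rewrite Rabs_left by lra. ring. }
  rewrite Hsplit.
  assert (H1 := HM _ (NoDup_filter p HL)).
  assert (H2 := HM _ (NoDup_filter (fun n => negb (p n)) HL)).
  assert (H3 := Hphi (sum_over (filter p L) t)).
  assert (H4 := Hphi (sum_over (filter (fun n => negb (p n)) L) t)).
  apply Rabs_le_between in H3. apply Rabs_le_between in H4. lra.
Qed.

Lemma Cmod_le_Re_Im (z : C) : Cmod z <= Rabs (Re z) + Rabs (Im z).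
Proof.
  destruct z as [x y]. unfold Cmod, Re, Im; simpl.
  assert (Hx := Rabs_pos x). assert (Hy := Rabs_pos y).
  rewrite <- (sqrt_Rsqr (Rabs x + Rabs y)) by lra.
  apply sqrt_le_1_alt. unfold Rsqr.
  assert (Hx2 := Rsqr_abs x). assert (Hy2 := Rsqr_abs y).
  unfold Rsqr in *. nra.
Qed.

Lemma Im_le_Cmod (z : C) : Rabs (Im z) <= Cmod z.
Proof.
  eapply Rle_trans; [|apply Rmax_Cmod]. apply Rmax_r.
Qed.

(** The constant [4 * M] comes from [2 * M] for the real parts plus [2 * M] for the imaginary
    parts. *)
Lemma ex_series_Cmod_of_finite_sums (t : nat -> C) (M : R) :
  (forall N, NoDup N -> Cmod (sum_over N t) <= M) ->
  ex_series (fun n => Cmod (t n)).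
Proof.
  intros HM. apply (ex_series_nonneg_bounded _ (4 * M)).
  - intros n. apply Cmod_ge_0.
  - intros n. rewrite <- sumR_over_seq.
    eapply Rle_trans.
    { apply sumR_over_le. intros k. apply Cmod_le_Re_Im. }
    rewrite sumR_over_plus.
    assert (HL := seq_NoDup (S n) 0).
    assert (H1 := sumR_over_Rabs_le Re t M _ eq_refl
      (fun _ _ => eq_refl) re_le_Cmod HM HL).
    assert (H2 := sumR_over_Rabs_le Im t M _ eq_refl
      (fun _ _ => eq_refl) Im_le_Cmod HM HL).
    lra.
Qed.

Lemma sup_finite_lt_p_infty (d : nat -> nat -> C) :
  Rbar_lt (sup_finite d) p_infty <->
  exists M : R, forall N K : list nat, NoDup N -> NoDup K ->
    Cmod (sum_over N (fun n => sum_over K (d n))) <= M.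
Proof.
  unfold sup_finite.
  match goal with |- context [Lub_Rbar ?E] =>
    destruct (Lub_Rbar_correct E) as [Hub Hlub];
    destruct (Lub_Rbar E) as [l| |] end; split.
  - intros _. exists l. intros N K HN HK. apply (Hub _).
    exists N, K. auto.
  - intros _. exact I.
  - intros [].
  - intros [M HM]. apply (Hlub (Finite M)).
    intros r (N & K & HN & HK & ->). apply HM; trivial.
  (* The supremum is not minus infinity, because the empty sets give the value 0. *)
  - intros _. exfalso. apply (Hub 0). exists nil, nil.
    repeat split; try constructor. symmetry. apply Cmod_0.
  - intros _. exact I.
Qed.

(** * The transform [Lambda] and its inversion *)

Section Cesaro.

Variable lam : nat -> R.
Hypothesis lam_pos : forall n : nat, 0 < lam n.
Hypothesis lam_incr : forall m n : nat, (m < n)%nat -> lam m < lam n.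

Let delta (n : nat) : R := lam n - prevR lam n.

(** The terms of the series whose convergence characterises all the duals and both sets. *)
Let weight (a : w) (n : nat) : R := lam n / delta n * Cmod (a n).

Lemma delta_pos (n : nat) : 0 < delta n.
Proof.
  unfold delta. destruct n as [|n]; simpl.
  - specialize (lam_pos 0). lra.
  - specialize (lam_incr n (S n) (Nat.lt_succ_diag_r n)). lra.
Qed.

Lemma prevR_lam_ge_0 (n : nat) : 0 <= prevR lam n.
Proof. destruct n as [|n]; simpl; [lra|apply Rlt_le, lam_pos]. Qed.

Lemma prevR_lam_le (n : nat) : prevR lam n <= lam n.
Proof. assert (H := delta_pos n). unfold delta in H. lra. Qed.

Lemma ratio_pos (n : nat) : 0 < lam n / delta n.
Proof. apply Rdiv_lt_0_compat; [apply lam_pos|apply delta_pos]. Qed.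

Lemma weight_ge_0 (a : w) (n : nat) : 0 <= weight a n.
Proof.
  apply Rmult_le_pos; [apply Rlt_le, ratio_pos|apply Cmod_ge_0].
Qed.

Lemma lam_mult_Lambda (x : w) (n : nat) :
  (RtoC (lam n) * Lambda lam x n)%C =
  sum_n (fun k => (RtoC (delta k) * x k)%C) n.
Proof.
  unfold Lambda. rewrite Cmult_assoc, <- RtoC_mult.
  replace (lam n * (1 / lam n)) with 1
    by (field; apply Rgt_not_eq, lam_pos).
  apply Cmult_1_l.
Qed.

(** Inverts [Lambda] by subtracting consecutive weighted sums; at index 0 the convention for
    negative indices removes the second term. *)
Lemma delta_mult (x : w) (n : nat) :
  (RtoC (delta n) * x n)%C =
  (RtoC (lam n) * Lambda lam x n
   - RtoC (prevR lam n) * prevC (Lambda lam x) n)%C.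
Proof.
  rewrite lam_mult_Lambda. destruct n as [|n]; simpl.
  - rewrite sum_O. ring.
  - rewrite lam_mult_Lambda, sum_Sn. unfold plus; simpl. ring.
Qed.

(** Builds a preimage under [Lambda] of a prescribed real [y]: the weighted sum of [x] telescopes to
    [lam n * y n], and [lam n] cancels. *)
Lemma Lambda_RtoC (x y : nat -> R) (n : nat) :
  (forall k, delta k * x k = lam k * y k - prevR lam k * prevR y k) ->
  Lambda lam (fun k => RtoC (x k)) n = RtoC (y n).
Proof.
  intros Hxy.
  assert (Hlam : RtoC (lam n) <> 0%C)
    by (intros H; apply RtoC_inj in H; specialize (lam_pos n); lra).
  assert (H : (RtoC (lam n) * Lambda lam (fun k => RtoC (x k)) n)%C
              = (RtoC (lam n) * RtoC (y n))%C).
  { rewrite lam_mult_Lambda. clear Hlam. induction n as [|n IH].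
    - rewrite sum_O, <- !RtoC_mult, Hxy. simpl. f_equal. ring.
    - rewrite sum_Sn, IH, <- !RtoC_mult, Hxy. unfold plus; simpl.
      rewrite <- RtoC_plus. f_equal. ring. }
  rewrite <- (Cmult_1_l (Lambda _ _ _)), <- (Cmult_1_l (RtoC (y n))).
  rewrite <- (Cinv_l _ Hlam), <- !Cmult_assoc, H. reflexivity.
Qed.

(** * The duals and the summability of [weight a] *)

Lemma cs0_lambda_cs_lambda (x : w) : cs0_lambda lam x -> cs_lambda lam x.
Proof. intros H. exists (RtoC 0). exact H. Qed.

Lemma cs_lambda_bs_lambda (x : w) : cs_lambda lam x -> bs_lambda lam x.
Proof.
  intros H. destruct (filterlim_bounded _ H) as [M HM].
  exists M. exact HM.
Qed.

Lemma alpha_dual_antitone (X Y : w -> Prop) (a : w) :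
  (forall x, X x -> Y x) -> alpha_dual Y a -> alpha_dual X a.
Proof. intros HXY HY x Hx. apply HY, HXY, Hx. Qed.

Lemma bs_Cmod_le (y : w) (M : R) :
  (forall m, Cmod (sum_n y m) <= M) -> forall n, Cmod (y n) <= 2 * M.
Proof.
  intros HM n.
  (* These two facts give 0 <= [M], needed for the term of index 0, which is only known to be at
     most [M]. *)
  assert (H0 := HM 0%nat). assert (H0' := Cmod_ge_0 (sum_n y 0)).
  destruct n as [|n].
  - rewrite sum_O in *. lra.
  - replace (y (S n)) with (sum_n y (S n) + - sum_n y n)%C
      by (rewrite sum_Sn; unfold plus; simpl; ring).
    eapply Rle_trans; [apply Cmod_triangle|]. rewrite Cmod_opp.
    assert (H1 := HM n). assert (H2 := HM (S n)). lra.
Qed.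

Lemma alpha_dual_bs_of_summable (a : w) :
  ex_series (weight a) -> alpha_dual (bs_lambda lam) a.
Proof.
  intros Ha x [M HM]. unfold l1.
  apply (ex_series_le (V := R_CompleteNormedModule) _
    (fun n => scal (4 * M) (weight a n))).
  2: { apply (ex_series_scal (4 * M) (weight a)). exact Ha. }
  intros n. unfold norm, scal; simpl. unfold abs, mult; simpl.
  rewrite Rabs_pos_eq by apply Cmod_ge_0. rewrite Cmod_mult.
  assert (Hy := bs_Cmod_le _ _ HM).
  assert (Hy1 := Hy n).
  assert (Hy2 : Cmod (prevC (Lambda lam x) n) <= 2 * M).
  { destruct n as [|n]; simpl; [|apply Hy].
    rewrite Cmod_0. eapply Rle_trans; [apply Cmod_ge_0|apply Hy1]. }
  assert (Hd := delta_pos n).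
  (* Both y_n and y_(n-1) are at most 2M in modulus, and lam_(n-1) <= lam_n, whence 2M + 2M. *)
  assert (Hx : delta n * Cmod (x n) <= 4 * M * lam n).
  { rewrite <- (Rabs_pos_eq (delta n)), <- Cmod_R, <- Cmod_mult by lra.
    rewrite delta_mult. unfold Cminus.
    eapply Rle_trans; [apply Cmod_triangle|].
    rewrite Cmod_opp, !Cmod_mult, !Cmod_R.
    assert (Hp := prevR_lam_ge_0 n). assert (Hl := prevR_lam_le n).
    rewrite !Rabs_pos_eq by lra.
    assert (H0 := Cmod_ge_0 (prevC (Lambda lam x) n)). nra. }
  replace (4 * M * weight a n)
    with (Cmod (a n) * (/ delta n * (4 * M * lam n)))
    by (unfold weight; field; lra).
  apply Rmult_le_compat_l; [apply Cmod_ge_0|].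
  apply Rmult_le_reg_l with (delta n); trivial.
  rewrite <- Rmult_assoc, Rinv_r, Rmult_1_l by lra. exact Hx.
Qed.

Lemma pow_m1_S (n : nat) : (-1) ^ S n = - (-1) ^ n.
Proof. simpl. ring. Qed.

(* The alternating signs make the contributions of [eps n], [eps (n - 1)] and
   [eps (n - 2)] to [a n * x n] add up without cancellation. *)
Lemma summable_of_alpha_dual_cs0 (a : w) :
  alpha_dual (cs0_lambda lam) a -> ex_series (weight a).
Proof.
  intros Ha. apply summable_of_null_weights; [apply weight_ge_0|].
  intros eps Hpos Hlim.
  (* Here [y] has partial sums (-1)^n eps_n, [z] is its modulus, and [x] is its preimage under
     [Lambda]. *)
  set (z := fun n => eps n + prevR eps n).
  set (y := fun n => (-1) ^ n * z n).
  set (x := fun n => (lam n * y n - prevR lam n * prevR y n) / delta n).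
  assert (HL : forall n, Lambda lam (fun k => RtoC (x k)) n = RtoC (y n)).
  { intros n. apply Lambda_RtoC. intros k. unfold x. field.
    apply Rgt_not_eq, delta_pos. }
  assert (Hsum : forall n, sum_n (Lambda lam (fun k => RtoC (x k))) n
                           = RtoC ((-1) ^ n * eps n)).
  { induction n as [|n IH].
    - rewrite sum_O, HL. unfold y, z; simpl. f_equal. ring.
    - rewrite sum_Sn, IH, HL. unfold plus, y, z; simpl.
      rewrite <- RtoC_plus. f_equal. ring. }
  assert (Hx : cs0_lambda lam (fun k => RtoC (x k))).
  { apply filterlim_locally. intros e.
    destruct (proj2 (is_lim_seq_spec _ _) Hlim e) as [m Hm].
    exists m. intros n Hn. apply C_NormedModule_mixin_compat1.
    rewrite Hsum. unfold minus, plus, opp; simpl.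
    replace (RtoC ((-1) ^ n * eps n) + - RtoC 0)%C
      with (RtoC ((-1) ^ n * eps n)) by ring.
    rewrite Cmod_R, Rabs_mult, pow_1_abs, Rmult_1_l.
    specialize (Hm n Hn). now rewrite Rminus_0_r in Hm. }
  specialize (Ha _ Hx). unfold l1 in Ha.
  refine (ex_series_le (V := R_CompleteNormedModule) _ _ _ Ha).
  intros n. unfold norm; simpl. unfold abs; simpl.
  rewrite Rabs_pos_eq
    by (apply Rmult_le_pos; [apply Rlt_le, Hpos|apply weight_ge_0]).
  rewrite Cmod_mult, Cmod_R.
  assert (Hd := delta_pos n).
  assert (Hz : forall k, eps k <= z k).
  { intros [|k]; unfold z; simpl; [lra|]. specialize (Hpos k). lra. }
  assert (Hxn : Rabs (x n) =
    (lam n * z n + prevR lam n * prevR z n) / delta n).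
  { unfold x. unfold Rdiv at 1. rewrite Rabs_mult, (Rabs_pos_eq (/ delta n))
      by (apply Rlt_le, Rinv_0_lt_compat; lra).
    unfold Rdiv. f_equal.
    replace (lam n * y n - prevR lam n * prevR y n)
      with ((-1) ^ n * (lam n * z n + prevR lam n * prevR z n)).
    2: { unfold y. destruct n as [|n]; simpl; ring. }
    rewrite Rabs_mult, pow_1_abs, Rmult_1_l. apply Rabs_pos_eq.
    apply Rplus_le_le_0_compat; apply Rmult_le_pos.
    - apply Rlt_le, lam_pos.
    - eapply Rle_trans; [apply Rlt_le, Hpos|apply Hz].
    - apply prevR_lam_ge_0.
    - destruct n as [|n]; simpl; [lra|].
      eapply Rle_trans; [apply Rlt_le, Hpos|apply Hz]. }
  rewrite Hxn. unfold weight.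
  replace (eps n * (lam n / delta n * Cmod (a n)))
    with (Cmod (a n) * (lam n * eps n / delta n)) by (field; lra).
  apply Rmult_le_compat_l; [apply Cmod_ge_0|].
  apply Rmult_le_compat_r; [apply Rlt_le, Rinv_0_lt_compat; lra|].
  (* Of the nonnegative terms making up |x_n|, only lam_n eps_n / delta_n is kept. *)
  specialize (Hz n). assert (Hl := lam_pos n).
  assert (0 <= prevR lam n * prevR z n).
  { apply Rmult_le_pos; [apply prevR_lam_ge_0|].
    destruct n as [|n]; simpl; [lra|]. unfold z.
    destruct n as [|n]; simpl.
    - specialize (Hpos 0%nat). lra.
    - assert (H1 := Hpos n). assert (H2 := Hpos (S n)). lra. }
  nra.
Qed.

(** * From summability to bounded double sums *)

Lemma Cmod_B_lambda_le (a : w) (n k : nat) :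
  Cmod (B_lambda lam a n k) <=
  weight a n * (indicator n k + indicator (n - 1) k).
Proof.
  assert (Hw := weight_ge_0 a n).
  assert (H1 := indicator_ge_0 n k). assert (H2 := indicator_ge_0 (n - 1) k).
  unfold B_lambda.
  destruct (Nat.leb_spec n (k + 1)) as [Hn|Hn]; simpl.
  2: { rewrite Cmod_0. nra. }
  destruct (Nat.leb_spec k n) as [Hk|Hk].
  2: { rewrite Cmod_0. nra. }
  (* Row [n] lives on the columns [n] and [n - 1]. For [n = 0] truncation makes them coincide, which
     only weakens the bound. *)
  assert (Hind : 1 <= indicator n k + indicator (n - 1) k).
  { assert (k = n \/ k = n - 1)%nat as [H|H] by lia;
      rewrite (indicator_eq _ _ H); lra. }
  rewrite Cmod_mult, Cmod_R, Rabs_mult, pow_1_abs, Rmult_1_l.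
  assert (Hle : lam k <= lam n).
  { destruct (Nat.eq_dec k n) as [->|Hkn]; [lra|].
    apply Rlt_le, lam_incr. lia. }
  assert (Hd := delta_pos n). assert (Hl := lam_pos k).
  rewrite Rabs_pos_eq by (apply Rlt_le, Rdiv_lt_0_compat; trivial).
  apply Rle_trans with (weight a n); [|nra].
  apply Rmult_le_compat_r; [apply Cmod_ge_0|].
  apply Rmult_le_compat_r; [|exact Hle].
  apply Rlt_le, Rinv_0_lt_compat; exact Hd.
Qed.

(** The functions [i1] to [i4] locate the columns where row [n] may be nonzero. A duplicate-free [K]
    meets each at most once, so row [n] contributes at most [4 * weight a n]. *)
Lemma sup_finite_of_summable (a : w) (d : nat -> nat -> C)
    (i1 i2 i3 i4 : nat -> nat) :
  (forall n k, Cmod (d n k) <= weight a n *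
     (indicator (i1 n) k + indicator (i2 n) k
      + (indicator (i3 n) k + indicator (i4 n) k))) ->
  ex_series (weight a) -> Rbar_lt (sup_finite d) p_infty.
Proof.
  intros Hd [l Hl]. apply sup_finite_lt_p_infty.
  exists (4 * l). intros N K HN HK.
  eapply Rle_trans; [apply Cmod_sum_over_le|].
  apply Rle_trans with (sumR_over N (fun n => 4 * weight a n)).
  - apply sumR_over_le. intros n.
    eapply Rle_trans; [apply Cmod_sum_over_le|].
    eapply Rle_trans; [apply sumR_over_le, Hd|].
    rewrite sumR_over_scal, !sumR_over_plus.
    assert (H := fun j => sumR_over_indicator_le K j HK).
    assert (H1 := H (i1 n)). assert (H2 := H (i2 n)).
    assert (H3 := H (i3 n)). assert (H4 := H (i4 n)).
    assert (Hw := weight_ge_0 a n). nra.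
  - rewrite sumR_over_scal. apply Rmult_le_compat_l; [lra|].
    apply sumR_over_le_is_series; trivial. apply weight_ge_0.
Qed.

Lemma indicator_shift (i j k k' : nat) :
  (k' = i -> k = j)%nat -> indicator i k' <= indicator j k.
Proof.
  intros H. unfold indicator at 1. destruct (Nat.eqb_spec k' i) as [E|_].
  - rewrite indicator_eq by auto. lra.
  - apply indicator_ge_0.
Qed.

Lemma m1_of_summable (a : w) : ex_series (weight a) -> m1_lambda lam a.
Proof.
  (* The entry b_(n,k-1) can be nonzero only if k - 1 is n or n - 1, which moves the columns one to
     the right. *)
  apply (sup_finite_of_summable a _
    (fun n => n) (fun n => n - 1)%nat S (fun n => S (n - 1))).
  intros n k. unfold Cminus.
  eapply Rle_trans; [apply Cmod_triangle|].
  rewrite Cmod_opp, Rmult_plus_distr_l.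
  apply Rplus_le_compat; [apply Cmod_B_lambda_le|].
  destruct k as [|k]; simpl.
  - rewrite Cmod_0. apply Rmult_le_pos; [apply weight_ge_0|].
    apply Rplus_le_le_0_compat; apply indicator_ge_0.
  - eapply Rle_trans; [apply Cmod_B_lambda_le|].
    apply Rmult_le_compat_l; [apply weight_ge_0|].
    apply Rplus_le_compat; apply indicator_shift; lia.
Qed.

Lemma m2_of_summable (a : w) : ex_series (weight a) -> m2_lambda lam a.
Proof.
  (* For b_(n,k+1) the columns move one to the left. Truncation is harmless, since only an upper
     bound is sought. *)
  apply (sup_finite_of_summable a _
    (fun n => n) (fun n => n - 1)%nat
    (fun n => n - 1)%nat (fun n => n - 1 - 1)%nat).
  intros n k. unfold Cminus.
  eapply Rle_trans; [apply Cmod_triangle|].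
  rewrite Cmod_opp, Rmult_plus_distr_l.
  apply Rplus_le_compat; [apply Cmod_B_lambda_le|].
  eapply Rle_trans; [apply Cmod_B_lambda_le|].
  apply Rmult_le_compat_l; [apply weight_ge_0|].
  apply Rplus_le_compat; apply indicator_shift; lia.
Qed.

(** * From bounded double sums to summability *)

Let evens (m : nat) : list nat := map (fun i => 2 * i)%nat (seq 0 (S m)).

Lemma NoDup_evens (m : nat) : NoDup (evens m).
Proof.
  apply FinFun.Injective_map_NoDup; [|apply seq_NoDup].
  intros i j H. lia.
Qed.

Lemma sum_over_app (N K : list nat) (f : nat -> C) :
  sum_over (N ++ K) f = (sum_over N f + sum_over K f)%C.
Proof.
  unfold sum_over. induction N as [|n N IH]; simpl; [ring|].
  rewrite IH. ring.
Qed.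

Lemma sum_over_evens_S (m : nat) (f : nat -> C) :
  sum_over (evens (S m)) f = (sum_over (evens m) f + f (2 * S m)%nat)%C.
Proof.
  unfold evens. rewrite (seq_S (S m)), map_app, sum_over_app.
  unfold sum_over at 2. simpl map. simpl fold_right. rewrite Cplus_0_r.
  reflexivity.
Qed.

Let alt (f : nat -> C) (k : nat) : C := (RtoC ((-1) ^ k) * f k)%C.

(** The pairs (2i, 2i+1) with i <= m tile the indices from 0 to 2m+1, the odd ones carrying a minus
    sign. *)
Lemma sum_over_evens_forward (m : nat) (f : nat -> C) :
  sum_over (evens m) (fun k => (f k - f (k + 1)%nat)%C) =
  sum_n (alt f) (2 * m + 1).
Proof.
  induction m as [|m IH].
  - change (2 * 0 + 1)%nat with 1%nat. rewrite sum_Sn, sum_O.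
    unfold alt, plus. rewrite pow_m1_S, pow_O, RtoC_opp.
    unfold sum_over; simpl. ring.
  - rewrite sum_over_evens_S, IH.
    assert (Hpow := pow_1_even (S m)).
    replace (2 * S m + 1)%nat with (S (S (2 * m + 1))) by lia.
    replace (2 * S m)%nat with (S (2 * m + 1)) in * by lia.
    rewrite !sum_Sn. unfold alt, plus.
    rewrite (pow_m1_S (S _)), Hpow, RtoC_opp.
    simpl. ring.
Qed.

(** Here the pairs are (2i-1, 2i), and the one for i = 0 reduces to [f 0], so the tiling ends at
    2m. *)
Lemma sum_over_evens_backward (m : nat) (f : nat -> C) :
  sum_over (evens m) (fun k => (f k - prevC f k)%C) = sum_n (alt f) (2 * m).
Proof.
  induction m as [|m IH].
  - rewrite sum_O. unfold alt, sum_over; simpl. ring.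
  - rewrite sum_over_evens_S, IH.
    replace (2 * S m)%nat with (S (S (2 * m))) by lia.
    rewrite !sum_Sn. unfold alt, plus. rewrite !pow_m1_S, pow_1_even.
    rewrite Ropp_involutive, RtoC_opp. simpl. ring.
Qed.

Lemma B_lambda_eq_0 (a : w) (n k : nat) :
  (k + 1 < n \/ n < k)%nat -> B_lambda lam a n k = RtoC 0.
Proof.
  intros H. unfold B_lambda.
  destruct (Nat.leb_spec n (k + 1)); destruct (Nat.leb_spec k n);
    simpl; trivial; lia.
Qed.

(** Since (-1)^k (-1)^(n-k) = (-1)^n, the sign no longer depends on the column. *)
Lemma alt_B_lambda (a : w) (n k : nat) : (n <= k + 1)%nat -> (k <= n)%nat ->
  alt (B_lambda lam a n) k = (RtoC ((-1) ^ n * (lam k / delta n)) * a n)%C.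
Proof.
  intros Hn Hk. unfold alt, B_lambda.
  rewrite (proj2 (Nat.leb_le _ _) Hn), (proj2 (Nat.leb_le _ _) Hk); simpl.
  rewrite Cmult_assoc, <- RtoC_mult, <- Rmult_assoc, <- pow_add.
  replace (k + (n - k))%nat with n by lia. reflexivity.
Qed.

(** Once [p] reaches [n], the sum contains the whole row: the entries in columns n - 1 and n, now of
    equal sign, add up. *)
Lemma sum_n_alt_B_lambda (a : w) (n p : nat) : (n <= p)%nat ->
  sum_n (alt (B_lambda lam a n)) p =
  (RtoC ((-1) ^ n * ((lam n + prevR lam n) / delta n)) * a n)%C.
Proof.
  intros Hp.
  assert (Hzero : forall q, (q + 1 < n)%nat ->
            sum_n (alt (B_lambda lam a n)) q = RtoC 0).
  { induction q as [|q IH]; intros Hq.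
    - rewrite sum_O. unfold alt. rewrite B_lambda_eq_0 by lia.
      apply Cmult_0_r.
    - rewrite sum_Sn, IH by lia. unfold alt.
      rewrite B_lambda_eq_0, Cmult_0_r by lia. apply Cplus_0_l. }
  induction Hp as [|p Hp IH].
  - destruct n as [|n].
    + rewrite sum_O, alt_B_lambda by lia. simpl prevR.
      now rewrite Rplus_0_r.
    + rewrite sum_Sn, (alt_B_lambda a (S n) (S n)) by lia.
      replace (sum_n (alt (B_lambda lam a (S n))) n)
        with (alt (B_lambda lam a (S n)) n).
      * rewrite alt_B_lambda by lia. unfold plus; simpl prevR.
        unfold Rdiv. rewrite Rmult_plus_distr_r, Rmult_plus_distr_l, RtoC_plus.
        simpl. ring.
      * destruct n as [|n]; [now rewrite sum_O|].
        rewrite sum_Sn, Hzero by lia. symmetry. apply Cplus_0_l.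
  - rewrite sum_Sn, IH. unfold alt.
    rewrite B_lambda_eq_0, Cmult_0_r by lia. apply Cplus_0_r.
Qed.

(* Both differences telescope over an initial segment of the even numbers to
   [sum_k (-1)^k b_nk], whose two terms have the same sign. *)
Lemma summable_of_sup_finite (a : w) (d : nat -> nat -> C) (p : nat -> nat) :
  (forall m, m <= p m)%nat ->
  (forall m n, sum_over (evens m) (d n) =
               sum_n (alt (B_lambda lam a n)) (p m)) ->
  Rbar_lt (sup_finite d) p_infty -> ex_series (weight a).
Proof.
  intros Hp Hd Hsup.
  destruct (proj1 (sup_finite_lt_p_infty d) Hsup) as [M HM].
  set (t := fun n =>
    (RtoC ((-1) ^ n * ((lam n + prevR lam n) / delta n)) * a n)%C).
  assert (Ht : ex_series (fun n => Cmod (t n))).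
  { apply (ex_series_Cmod_of_finite_sums t M). intros N HN.
    assert (Hmax := proj1 (list_max_le N _) (Nat.le_refl _)).
    (* A single [m] serves all rows in [N]: [p m] is at least every element of [N], so each inner
       sum is a complete row sum. *)
    set (m := list_max N) in *.
    specialize (HM N (evens m) HN (NoDup_evens m)).
    replace (sum_over N t)
      with (sum_over N (fun n => sum_over (evens m) (d n))); trivial.
    unfold sum_over at 1 3. f_equal. apply map_ext_in. intros n Hn.
    rewrite Forall_forall in Hmax. specialize (Hmax n Hn).
    rewrite Hd. apply sum_n_alt_B_lambda. specialize (Hp m). lia. }
  refine (ex_series_le (V := R_CompleteNormedModule) _ _ _ Ht).
  intros n. unfold norm; simpl. unfold abs; simpl.
  rewrite Rabs_pos_eq by apply weight_ge_0.
  unfold t. rewrite Cmod_mult, Cmod_R, Rabs_mult, pow_1_abs, Rmult_1_l.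
  apply Rmult_le_compat_r; [apply Cmod_ge_0|].
  eapply Rle_trans; [|apply Rle_abs].
  apply Rmult_le_compat_r; [apply Rlt_le, Rinv_0_lt_compat, delta_pos|].
  assert (H := prevR_lam_ge_0 n). lra.
Qed.

Lemma summable_of_m1 (a : w) : m1_lambda lam a -> ex_series (weight a).
Proof.
  apply (summable_of_sup_finite a _ (fun m => 2 * m)%nat); [lia|].
  intros m n. apply sum_over_evens_backward.
Qed.

Lemma summable_of_m2 (a : w) : m2_lambda lam a -> ex_series (weight a).
Proof.
  apply (summable_of_sup_finite a _ (fun m => 2 * m + 1)%nat); [lia|].
  intros m n. apply sum_over_evens_forward.
Qed.

End Cesaro.

Theorem theorem5p10 :
  forall lam : nat -> R,
    (forall n : nat, (0 < lam n)%R) ->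
    (forall m n : nat, (m < n)%nat -> (lam m < lam n)%R) ->
    is_lim_seq lam p_infty ->
    (forall a : w, alpha_dual (cs_lambda lam) a <-> m1_lambda lam a) /\
    (forall a : w, alpha_dual (cs0_lambda lam) a <-> alpha_dual (bs_lambda lam) a) /\
    (forall a : w, alpha_dual (bs_lambda lam) a <-> m2_lambda lam a).
Proof.
  intros lam Hpos Hincr _.
  (* The inclusions of cs0 in cs in bs reverse for duals. Passing from the cs0-dual to summability
     and on to the bs-dual closes the cycle. *)
  assert (H0c := fun a => alpha_dual_antitone _ _ a (cs0_lambda_cs_lambda lam)).
  assert (Hcb := fun a => alpha_dual_antitone _ _ a (cs_lambda_bs_lambda lam)).
  assert (H0 := summable_of_alpha_dual_cs0 lam Hpos Hincr).
  assert (Hb := alpha_dual_bs_of_summable lam Hpos Hincr).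
  repeat split.
  - intros Ha. apply m1_of_summable; auto.
  - intros Ha. apply Hcb, Hb, summable_of_m1; auto.
  - auto.
  - auto.
  - intros Ha. apply m2_of_summable; auto.
  - intros Ha. apply Hb, summable_of_m2; auto.
Qed.
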